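(* Let $\omega=\omega(n)$ be any function with $\omega(n)\to\infty$ as $n\to\infty$, and let $\gamma\in(0,1)$ be a constant. If the edge-probability $p=p(n)$ satisfies $\gamma\le p<1$, then there is an interval of length $\lfloor C\omega\sqrt{n}/\log_{1/(1-p)}(n)\rfloor$ that contains $\chi(G_{n,p})$ with high probability, where $C=C(\gamma)>0$ is a constant.
   Context: $G_{n,p}$ denotes the binomial random graph on vertex set $[n]$ in which each pair of vertices is an edge independently with probability $p$; $\chi$ denotes the chromatic number. ''With high probability'' means with probability tending to $1$ as $n\to\infty$. ''There is an interval of length $\ell(n)$ that contains $\chi(G_{n,p})$ with high probability'' means there exist intervals $I_n$ of length $\ell(n)$ with $\Pr(\chi(G_{n,p})\in I_n)\to1$. *)

(* Defs.v *)
From HB Require Import structures.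
From mathcomp Require Import all_boot all_order all_algebra.
From mathcomp Require Import all_classical all_reals all_analysis.
Set Implicit Arguments. Unset Strict Implicit. Unset Printing Implicit Defensive.
Import Order.TTheory GRing.Theory Num.Theory.
Local Open Scope ring_scope.

(* A (simple) graph on vertex set 'I_n (= [n]) is given by its edge set,
   a set of 2-element subsets of 'I_n. *)
Definition pairs (n : nat) : {set {set 'I_n}} := [set e : {set 'I_n} | #|e| == 2%N].

Definition gnp_weight (R : realType) (n : nat) (p : R) (E : {set {set 'I_n}}) : R :=
  if E \subset pairs n then
    \prod_(e in pairs n) (if e \in E then p else 1 - p)
  else 0.

Definition gnp_prob (R : realType) (n : nat) (p : R) (A : pred {set {set 'I_n}}) : R :=
  \sum_(E | A E) gnp_weight p E.

Definition colorable (n : nat) (E : {set {set 'I_n}}) (k : nat) : bool :=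
  [exists f : {ffun 'I_n -> 'I_k},
     [forall u, forall v, ((u != v) && ([set u; v] \in E)) ==> (f u != f v)]].

Lemma colorable_n (n : nat) (E : {set {set 'I_n}}) : colorable E n.
Proof.
apply/existsP; exists [ffun u => u]; apply/forallP => u; apply/forallP => v.
by apply/implyP => /andP[huv _]; rewrite !ffunE.
Qed.

Definition chi (n : nat) (E : {set {set 'I_n}}) : nat :=
  ex_minn (ex_intro (fun k => colorable E k) n (colorable_n E)).

Definition logb (R : realType) (b x : R) : R := ln x / ln b.

(* Main.v *)
Require Import Defs.
From HB Require Import structures.
From mathcomp Require Import all_boot all_order all_algebra.
From mathcomp Require Import all_classical all_reals all_analysis.
From mathcomp Require Import ring lra zify.
Import Order.TTheory GRing.Theory Num.Theory.
Import numFieldNormedType.Exports.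
Local Open Scope classical_set_scope.
Local Open Scope ring_scope.

(** Let [k] be the least integer with [P(chi <= k) >= 4 / omega^2], so that
    [chi < k] is unlikely. The least number [f] of vertices whose removal leaves
    a [k]-colourable graph changes by at most 1 when the edges at one vertex
    change, hence has variance at most [n]. As [f = 0] with probability at least
    [4 / omega^2], Chebyshev's inequality gives [f <= omega sqrt n] outside an
    event of probability at most [4 / omega^2].

    It remains to colour the [f] leftover vertices with few colours. Put
    [b = 1 / (1 - p)]. If [log_b n] is bounded, use one colour per vertex.
    Otherwise, with high probability every set [U] of at least [n^(1/4)] vertices
    contains a vertex with at least [(1 - p) |U| / 16] non-neighbours in [U], by
    an exponential moment bound on the number of non-edges inside [U]. Passing
    repeatedly to such non-neighbourhoods yields, in every set of [n^(3/8)]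
    vertices, an independent set of size of order [log n / log (16 b)], which is
    of order [log_b n] since [b >= 1 / (1 - gamma) > 1]. Removing such sets
    greedily uses [O(omega sqrt n / log_b n)] colours. *)

(** * Product measures on subsets of a finite type *)

Section ProductMeasure.
Context {R : realType} {T : finType} (F : T -> R).
Hypothesis F01 : forall e, 0 <= F e <= 1.
Implicit Types (E : {set T}) (A B D : pred {set T}) (f g : {set T} -> R) (e : T)
  (s : seq T).

Definition weight E : R := \prod_e (if e \in E then F e else 1 - F e).

Definition esp f : R := \sum_E weight E * f E.

Lemma weight_ge0 E : 0 <= weight E.
Proof.
apply: prodr_ge0 => e _; have /andP[? ?] := F01 e.
by case: ifP => _ //; rewrite subr_ge0.
Qed.

Lemma le_esp f g : (forall E, f E <= g E) -> esp f <= esp g.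
Proof. by move=> fg; apply: ler_sum => E _; rewrite ler_wpM2l ?weight_ge0. Qed.

Lemma eq_esp f g : f =1 g -> esp f = esp g.
Proof. by move=> fg; apply: eq_bigr => E _; rewrite fg. Qed.

Lemma espD f g : esp (fun E => f E + g E) = esp f + esp g.
Proof. by rewrite /esp -big_split; apply: eq_bigr => E _; rewrite mulrDr. Qed.

Lemma espZ c f : esp (fun E => c * f E) = c * esp f.
Proof. by rewrite /esp big_distrr; apply: eq_bigr => E _; rewrite mulrCA. Qed.

Lemma esp_sum (I : finType) (P : pred I) (f : I -> {set T} -> R) :
  esp (fun E => \sum_(i | P i) f i E) = \sum_(i | P i) esp (f i).
Proof.
rewrite /esp [RHS]exchange_big; apply: eq_bigr => E _.
by rewrite big_distrr.
Qed.

(** Independence of the coordinates: expanding the product of two-term sums produces one term per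
    set [E]. *)
Lemma esp_prod (g h : T -> R) :
  esp (fun E => \prod_e (if e \in E then g e else h e)) =
  \prod_e (F e * g e + (1 - F e) * h e).
Proof.
rewrite bigA_distr; apply: eq_bigr => E _; rewrite -big_split.
by apply: eq_bigr => e _; case: ifP.
Qed.

Lemma esp_cst c : esp (fun=> c) = c.
Proof.
transitivity (esp (fun E => c * \prod_e (if e \in E then 1 else 1))).
  by apply: eq_esp => E; rewrite big1 ?mulr1// => e _; rewrite if_same.
rewrite espZ esp_prod big1 ?mulr1// => e _; ring.
Qed.

(** Conditional expectation of [f] given all coordinates but [e]; [resamples s] conditions on the
    coordinates outside [s]. *)
Definition resample e f E : R := F e * f (e |: E) + (1 - F e) * f (E :\ e).

Definition resamples s f : {set T} -> R := foldr resample f s.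

Definition agree_off s E E' := forall e, e \notin s -> (e \in E) = (e \in E').

Definition flip e E := if e \in E then E :\ e else e |: E.

Lemma in_flip e E e' : e' != e -> (e' \in flip e E) = (e' \in E).
Proof. by rewrite /flip => /negPf ee'; case: ifP => _; rewrite !inE ee'. Qed.

Lemma mem_flip e E : (e \in flip e E) = (e \notin E).
Proof. by rewrite /flip; case: ifP => eE; rewrite !inE eqxx. Qed.

Lemma flipK e : involutive (flip e).
Proof.
move=> E; apply/setP => e'; have [->|ee'] := eqVneq e' e.
  by rewrite !mem_flip negbK.
by rewrite !in_flip.
Qed.

(** The weighted defect [G] takes opposite values at [E] and [flip e E]. As flipping permutes the
    sets, the sum of [G] equals its own negative. *)
Lemma esp_resample e f : esp (resample e f) = esp f.
Proof.
pose G E := weight E * (resample e f E - f E).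
suff G0 : \sum_E G E = 0.
  apply: subr0_eq; rewrite /esp -sumrB -[RHS]G0.
  by apply: eq_bigr => E _; rewrite /G mulrBr.
have Gflip : \sum_E G E = \sum_E G (flip e E).
  by rewrite (reindex_inj (inv_inj (flipK e))).
suff : \sum_E G E + \sum_E G (flip e E) = 0 by rewrite -Gflip; lra.
rewrite -big_split; apply: big1 => E _ /=.
pose w' := \prod_(e' | e' != e) (if e' \in E then F e' else 1 - F e').
have wE : weight E = (if e \in E then F e else 1 - F e) * w'.
  by rewrite /weight (bigD1 e).
have wfE : weight (flip e E) = (if e \in E then 1 - F e else F e) * w'.
  rewrite /weight (bigD1 e)//= mem_flip if_neg; congr (_ * _).
  by apply: eq_bigr => e' ee'; rewrite in_flip.
have U1flip : e |: flip e E = e |: E.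
  by apply/setP => e'; rewrite !in_setU1; case: eqVneq => // ee'; rewrite in_flip.
have D1flip : flip e E :\ e = E :\ e.
  by apply/setP => e'; rewrite !in_setD1; case: eqVneq => // ee'; rewrite in_flip.
rewrite /G wE wfE /resample U1flip D1flip /flip; case: ifPn => eE.
  have -> : e |: E = E by apply/finset.setUidPr; rewrite finset.sub1set.
  by ring.
have -> : E :\ e = E by apply/finset.setDidPl; rewrite disjoint_sym disjoints1 eE.
by ring.
Qed.

Lemma esp_resamples s f : esp (resamples s f) = esp f.
Proof. by elim: s => [//|e s IH]; rewrite /= esp_resample. Qed.

Lemma agree_off_trans s E1 E2 E3 :
  agree_off s E1 E2 -> agree_off s E2 E3 -> agree_off s E1 E3.
Proof. by move=> h1 h2 e es; rewrite h1 ?h2. Qed.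

Lemma agree_offU1 s e E E' : agree_off s E E' -> agree_off s (e |: E) (e |: E').
Proof. by move=> h e' e's; rewrite !inE h. Qed.

Lemma agree_offD1 s e E E' : agree_off s E E' -> agree_off s (E :\ e) (E' :\ e).
Proof. by move=> h e' e's; rewrite !inE h. Qed.

Lemma resamples_le s E f g :
    (forall E', agree_off s E E' -> f E' <= g E') ->
  resamples s f E <= resamples s g E.
Proof.
(* The induction shortens the list while agreement stays relative to all of [s], hence the sublist
   [s'] and the moving base point [E1]. *)
have /(_ s) : forall s', {subset s' <= s} -> forall E1, agree_off s E E1 ->
    (forall E', agree_off s E E' -> f E' <= g E') ->
  resamples s' f E1 <= resamples s' g E1.
  elim=> [_ E1 EE1 h|e s' IH ss E1 EE1 h /=]; first exact: h.
  have es : e \in s by rewrite ss ?mem_head.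
  have ss' : {subset s' <= s} by move=> x xs; rewrite ss// in_cons xs orbT.
  have /andP[F0 F1] := F01 e.
  apply: lerD; apply: ler_wpM2l; rewrite ?subr_ge0 //; apply: IH => //;
    apply: agree_off_trans EE1 _ => e' e's; rewrite !inE;
    have /negPf -> // : e' != e by apply: contraNneq e's => ->.
by apply.
Qed.

Lemma resamplesD s f g E :
  resamples s (fun E => f E + g E) E = resamples s f E + resamples s g E.
Proof.
elim: s E => [//|e s IH] E /=; rewrite /resample !IH; ring.
Qed.

Lemma resamplesZ s c f E :
  resamples s (fun E => c * f E) E = c * resamples s f E.
Proof.
elim: s E => [//|e s IH] E /=; rewrite /resample !IH; ring.
Qed.

Lemma resamples_cst s c E : resamples s (fun=> c) E = c.
Proof.
elim: s E => [//|e s IH] E /=; rewrite /resample !IH; ring.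
Qed.

Lemma resamples_agree s f E E' :
  agree_off s E E' -> resamples s f E = resamples s f E'.
Proof.
elim: s E E' => [|e s IH] E E' EE' /=.
  by congr f; apply/setP => e; rewrite EE'.
by rewrite /resample; congr (_ * _ + _ * _); apply: IH => e' e's; rewrite !inE;
  case: eqP => //= /eqP ee'; rewrite EE'// in_cons negb_or ee'.
Qed.

Definition lipschitz1 s f := forall E E', agree_off s E E' -> f E <= f E' + 1.

Lemma resamples_lipschitz s s' f :
  lipschitz1 s f -> lipschitz1 s (resamples s' f).
Proof.
move=> fl; elim: s' => [//|e s' IH] E E' EE' /=; rewrite /resample.
have h1 := IH _ _ (agree_offU1 _ e _ _ EE').
have h2 := IH _ _ (agree_offD1 _ e _ _ EE').
have /andP[F0 F1] := F01 e.
have := ler_wpM2l F0 h1.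
have : 0 <= 1 - F e by lra.
move=> /ler_wpM2l/(_ _ _ h2); lra.
Qed.

(** The conditional variance given the coordinates outside [s] is at most 1. With [E] fixed,
    [(f E' - f E) ^+ 2 <= 1] for every [E'] agreeing with [E] off [s]; averaging its expansion over
    [E'] leaves the surplus square of [f E - resamples s f E], which is dropped. *)
Lemma esp_sqr_resamples s f : lipschitz1 s f ->
  esp (fun E => f E ^+ 2) <= esp (fun E => resamples s f E ^+ 2) + 1.
Proof.
move=> fl; rewrite -(esp_resamples s) -[X in _ + X](esp_cst 1) -espD.
apply: le_esp => E.
have : resamples s (fun E' => f E' ^+ 2 + (- (2 * f E)) * f E') E <=
       resamples s (fun=> 1 - f E ^+ 2) E.
  apply: resamples_le => E' EE'.
  have h1 := fl _ _ EE'.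
  have h2 : f E' <= f E + 1 by apply: fl => e es; rewrite EE'.
  by nra.
rewrite resamplesD resamplesZ resamples_cst.
have := sqr_ge0 (f E - resamples s f E); nra.
Qed.

(** Variance bound by the number of blocks. The blocks, which may overlap, are averaged out one at a
    time; the Lipschitz property survives each averaging, so each costs at most 1 in the second
    moment. Once all coordinates are covered, the function has become the constant [esp f]. *)
Lemma efron_stein (ss : seq (seq T)) f :
    (forall s, s \in ss -> lipschitz1 s f) ->
    (forall e, exists2 s, s \in ss & e \in s) ->
  esp (fun E => f E ^+ 2) <= esp f ^+ 2 + (size ss)%:R.
Proof.
move=> fl cov.
have step : forall ss', {subset ss' <= ss} ->
    esp (fun E => f E ^+ 2) <=
    esp (fun E => resamples (flatten ss') f E ^+ 2) + (size ss')%:R.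
  elim=> [_|s ss' IH sub] /=; first by rewrite addr0.
  have sub' : {subset ss' <= ss} by move=> x xs; rewrite sub// in_cons xs orbT.
  apply: (le_trans (IH sub')).
  have := @esp_sqr_resamples s (resamples (flatten ss') f).
  rewrite /resamples foldr_cat -/(resamples _ _) -natr1 => h.
  have {}h := h (@resamples_lipschitz s (flatten ss') f (fl s (sub s (mem_head _ _)))).
  rewrite -/(resamples s _); lra.
apply: (le_trans (step ss (fun x => id))); rewrite lerD2r.
have cst E : resamples (flatten ss) f E = resamples (flatten ss) f finset.set0.
  apply: resamples_agree => e; case: (cov e) => s sin es /flattenP h.
  by case: h; exists s.
have -> : esp f = resamples (flatten ss) f finset.set0.
  by rewrite -(esp_resamples (flatten ss)) (eq_esp _ _ cst) esp_cst.
rewrite (eq_esp _ (fun=> resamples (flatten ss) f finset.set0 ^+ 2)) ?esp_cst//.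
by move=> E; rewrite cst.
Qed.

Definition pr (A : pred {set T}) : R := esp (fun E => (A E)%:R).

Lemma pr_le A B : (forall E, A E -> B E) -> pr A <= pr B.
Proof.
by move=> AB; apply: le_esp => E; rewrite ler_nat; have := AB E; case: (A E) => // ->.
Qed.

Lemma pr_union A B D : (forall E, A E -> B E || D E) -> pr A <= pr B + pr D.
Proof.
move=> AB; rewrite /pr -espD; apply: le_esp => E; rewrite -natrD ler_nat.
by have := AB E; case: (A E) => //; case: (B E); case: (D E) => // /(_ isT).
Qed.

Lemma prC A : pr (fun E => ~~ A E) = 1 - pr A.
Proof.
apply/eqP; rewrite eq_sym subr_eq -(esp_cst 1) /pr -espD; apply/eqP.
by apply: eq_esp => E; case: (A E); rewrite /= ?addr0 ?add0r.
Qed.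

(* Chebyshev used twice: it first forces the mean below [r / 2] because [f]
   vanishes with non-negligible probability, and then bounds the upper tail. *)
Lemma pr_gt_of_pr_eq0 (ss : seq (seq T)) f (r : R) :
    (forall s, s \in ss -> lipschitz1 s f) ->
    (forall e, exists2 s, s \in ss & e \in s) ->
    0 < r -> (0 < size ss)%N ->
    4 * (size ss)%:R / r ^+ 2 <= pr (fun E => f E == 0) ->
  pr (fun E => r < f E) <= 4 * (size ss)%:R / r ^+ 2.
Proof.
move=> fl cov r0; rewrite -(ltr0n R) => N0; set N := (size ss)%:R in N0 *.
move=> h0; set m := esp f.
have V : esp (fun E => (f E - m) ^+ 2) <= N.
  rewrite (eq_esp _ (fun E => f E ^+ 2 + ((- (2 * m)) * f E + m ^+ 2))); last first.
    by move=> E; ring.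
  rewrite espD espD espZ esp_cst -/m.
  have := efron_stein ss f fl cov; rewrite -/m -/N; nra.
have r20 : 0 < r ^+ 2 by rewrite exprn_gt0.
have m2 : pr (fun E => f E == 0) * m ^+ 2 <= N.
  apply: le_trans V; rewrite mulrC -espZ; apply: le_esp => E.
  case: eqP => [->|_] /=; first by rewrite mulr1 sub0r sqrrN.
  by rewrite mulr0 sqr_ge0.
have mr : m <= r / 2.
  rewrite leNgt; apply/negP => rm.
  have : r ^+ 2 / 4 < m ^+ 2 by nra.
  have : 4 * N / r ^+ 2 * m ^+ 2 <= N.
    by apply: le_trans m2; rewrite ler_wpM2r ?sqr_ge0.
  rewrite mulrAC ler_pdivrMr // -mulrA mulrCA ler_pM2l // => h1 h2; lra.
rewrite ler_pdivlMr // mulrC.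
have : r ^+ 2 / 4 * pr (fun E => r < f E) <= N.
  apply: le_trans V; rewrite -espZ; apply: le_esp => E.
  case: ltP => /= h; last by rewrite mulr0 sqr_ge0.
  by rewrite mulr1; nra.
lra.
Qed.

End ProductMeasure.

(** * Colourings of induced subgraphs *)

Section Colouring.
Context {n : nat}.
Implicit Types (E : {set {set 'I_n}}) (U S : {set 'I_n}) (k l t : nat).

(* Colours are unbounded naturals outside [U], so that [U = set0] is
   [0]-colourable even when no function ['I_n -> 'I_0] exists. *)
Definition colours E U k (f : 'I_n -> nat) :=
  (forall u, u \in U -> (f u < k)%N) /\
  (forall u v, u \in U -> v \in U -> u != v -> [set u; v]%SET \in E -> f u != f v).

Definition colorable_on E U k := exists f, colours E U k f.

Lemma colorable_onT E k : colorable_on E [set: 'I_n]%SET k <-> colorable E k.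
Proof.
split=> [[f [fk fE]]|/existsP[f /forallP fE]].
  apply/existsP; exists [ffun u => Ordinal (fk u (finset.in_setT u))].
  apply/forallP => u; apply/forallP => v; apply/implyP => /andP[uv uvE].
  by rewrite !ffunE -val_eqE /=; apply: fE.
exists (fun u => val (f u)); split=> [u _|u v _ _ uv uvE]; first exact: ltn_ord.
by have /forallP/(_ v)/implyP := fE u; rewrite uv uvE val_eqE => /(_ isT).
Qed.

Lemma chi_leP E k : reflect (colorable_on E [set: 'I_n]%SET k) (chi E <= k)%N.
Proof.
apply: (iffP idP); rewrite /chi; case: ex_minnP => m mE min.
  move=> mk; have [f [fm fE]] := (colorable_onT E m).2 mE.
  by exists f; split=> // u uT; apply: leq_trans (fm u uT) mk.
by move=> /colorable_onT /min.
Qed.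

Lemma colorable_on_card E U : colorable_on E U #|U|.
Proof.
exists (fun u => index u (enum U)); split=> [u uU|u v uU vU uv _].
  by rewrite cardE index_mem mem_enum.
apply: contra_neq uv => iuv.
by rewrite -[u](@nth_index _ u _ (enum U)) ?mem_enum// iuv nth_index ?mem_enum.
Qed.

Lemma colorable_on_le E U k l : (k <= l)%N -> colorable_on E U k -> colorable_on E U l.
Proof.
by move=> kl [f [fk fE]]; exists f; split=> // u uU; apply: leq_trans (fk u uU) kl.
Qed.

Lemma colorable_onU E U S k l :
  colorable_on E U k -> colorable_on E S l -> colorable_on E (U :|: S) (k + l).
Proof.
move=> [f [fk fE]] [g [gl gE]].
exists (fun u => if u \in U then f u else (k + g u)%N).
split=> [u|u v].
  rewrite finset.in_setU; case: ifP => /= uU; first by move=> _; rewrite ltn_addr ?fk.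
  by move=> uS; rewrite ltn_add2l gl.
rewrite !finset.in_setU; case: ifPn => /= uU; case: ifPn => /= vU.
- by move=> _ _; apply: fE.
- by move=> _ _ _ _; have := fk u uU; lia.
- by move=> _ _ _ _; have := fk v vU; lia.
- by move=> uS vS uv uvE; have := gE u v uS vS uv uvE; lia.
Qed.

Definition indep E U := forall u v, u \in U -> v \in U -> u != v -> [set u; v]%SET \notin E.

Lemma indep_colorable_on E U : indep E U -> colorable_on E U 1.
Proof.
move=> iU; exists (fun=> 0%N); split=> // u v uU vU uv uvE.
by have := iU u v uU vU uv; rewrite uvE.
Qed.

(** While more than [s] vertices remain, one colour removes an independent set of size [t]; the last
    vertices, at most [s] of them, get a colour each. *)
Lemma colorable_on_greedy E t s U : (0 < t)%N ->
    (forall U', (s <= #|U'|)%N -> exists2 I : {set 'I_n}, I \subset U' & #|I| = t /\ indep E I) ->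
  colorable_on E U (#|U| %/ t + s).
Proof.
move=> t0 H; have [m] := ubnP #|U|; elim: m U => // m IH U Um.
have [Us|sU] := leqP #|U| s.
  by apply: colorable_on_le (colorable_on_card E U); rewrite (leq_trans Us)// leq_addl.
have [I IU [It iI]] := H _ (ltnW sU).
have cD : #|U :\: I| = (#|U| - t)%N by rewrite finset.cardsD (finset.setIidPr IU) It.
have tU : (t <= #|U|)%N by rewrite -It subset_leq_card.
have -> : (#|U| %/ t + s = 1 + (#|U :\: I| %/ t + s))%N.
  by rewrite cD addnA; congr (_ + _)%N; rewrite -{1}(subnK tU) divnDr ?dvdnn// divnn t0 addnC.
have {1}-> : U = I :|: (U :\: I) by rewrite -[LHS](finset.setID U I) (finset.setIidPr IU).
apply: colorable_onU; first exact: indep_colorable_on.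
by apply: IH; rewrite cD; lia.
Qed.

Definition nonnbrs E U v := [set w in U | (w != v) && ([set v; w]%SET \notin E)]%SET.

(** Choose [v] with many non-neighbours and continue among these: each chosen vertex costs a factor
    [d] in size, so [t] rounds can be run before the size falls below [m]. *)
Lemma indep_greedy (R : realType) E (d m : R) : 0 < d <= 1 ->
    (forall U, m <= #|U|%:R -> exists2 v, v \in U & d * #|U|%:R <= #|nonnbrs E U v|%:R) ->
  forall t U, m * d^-1 ^+ t <= #|U|%:R ->
    exists2 I : {set 'I_n}, I \subset U & #|I| = t /\ indep E I.
Proof.
move=> /andP[d0 d1] H; elim=> [|t IH] U hU.
  exists finset.set0; first exact: finset.sub0set.
  by split; [exact: finset.cards0|move=> u v; rewrite finset.in_set0].
have dV1 : 1 <= d^-1 by rewrite invf_ge1.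
have mU : m <= #|U|%:R.
  have [m0|m0] := leP m 0; first exact: le_trans m0 (ler0n _ _).
  by apply: le_trans hU; rewrite ler_peMr ?(ltW m0) ?exprn_ege1.
have [v vU hv] := H U mU.
have [|I IU [It iI]] := IH (nonnbrs E U v).
  by apply: le_trans hv; rewrite [leRHS]mulrC -ler_pdivrMr // -mulrA -exprSr.
have sub w : w \in I -> [/\ w \in U, w != v & [set v; w]%SET \notin E].
  by move=> /(fintype.subsetP IU); rewrite finset.inE => /and3P[].
exists (v |: I).
  by apply/fintype.subsetP => w; rewrite finset.in_setU1 => /orP[/eqP ->//|/sub[]].
split.
  rewrite finset.cardsU1 It; case: (boolP (v \in I)) => // /sub[_]; by rewrite eqxx.
move=> u w; rewrite !finset.in_setU1.
case: (eqVneq u v) => [->|uv]; case: (eqVneq w v) => [->|wv] //=.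
- by move=> _ /sub[].
- by move=> /sub[_ _ uvE] _ _; rewrite finset.setUC.
- exact: iI.
Qed.

(** The random variable of interest is [n - max_colorable k E], the least number of vertices whose
    deletion leaves a [k]-colourable graph. *)
Definition max_colorable k E := \max_(S : {set 'I_n} | `[< colorable_on E S k >]) #|S|.

Lemma colorable_on0 E k : colorable_on E finset.set0 k.
Proof. by exists (fun=> 0%N); split=> u; rewrite finset.in_set0. Qed.

Lemma max_colorableP k E :
  exists2 S, colorable_on E S k & #|S| = max_colorable k E.
Proof.
have [|S] := @eq_bigmax_cond _ (fun S => `[< colorable_on E S k >])
  (fun S : {set 'I_n} => #|S|).
  by apply/card_gt0P; exists finset.set0; apply/asboolP/colorable_on0.
by move=> /asboolP SE h; exists S => //; apply: esym h.
Qed.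

Lemma max_colorable_ge k E S : colorable_on E S k -> (#|S| <= max_colorable k E)%N.
Proof. by move=> SE; rewrite /max_colorable (bigD1 S) ?leq_maxl//; apply/asboolP. Qed.

Lemma max_colorable_le k E : (max_colorable k E <= n)%N.
Proof.
have [S _ <-] := max_colorableP k E.
by rewrite -[X in (_ <= X)%N]card_ord max_card.
Qed.

Lemma max_colorable_eq k E : (max_colorable k E == n) = (chi E <= k)%N.
Proof.
apply/eqP/chi_leP => [h|h].
  have [S SE] := max_colorableP k E; rewrite h => cS.
  suff <- : S = [set: 'I_n]%SET by [].
  by apply/eqP; rewrite finset.eqEcard finset.subsetT finset.cardsT card_ord cS leqnn.
apply/eqP; rewrite eqn_leq max_colorable_le /=.
by rewrite -[X in (X <= _)%N]card_ord -finset.cardsT max_colorable_ge.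
Qed.

(* Sets that are not pairs belong to every star, so that the stars cover
   all coordinates of the product space. *)
Definition star (v : 'I_n) : seq {set 'I_n} :=
  [seq e : {set 'I_n} <- enum {set 'I_n} | (v \in e) || (#|e| != 2%N)].

(** Deleting [v] from an optimal set for [E] leaves only pairs avoiding [v], on which [E] and [E']
    agree, so the old colouring still works. *)
Lemma max_colorable_star k v E E' : agree_off (star v) E E' ->
  (max_colorable k E <= (max_colorable k E').+1)%N.
Proof.
move=> EE'; have [S [f [fk fE]] <-] := max_colorableP k E.
have : (#|S :\ v| <= max_colorable k E')%N.
  apply: max_colorable_ge; exists f; split=> [u|u w].
    by rewrite finset.in_setD1 => /andP[_ /fk].
  rewrite !finset.in_setD1 => /andP[uv uS] /andP[wv wS] uw uwE.
  apply: fE => //; rewrite EE'// mem_filter mem_enum finset.in_set2 finset.cards2 uw.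
  by rewrite eqxx orbF andbT eq_sym (negPf uv) eq_sym (negPf wv).
rewrite -ltnS (finset.cardsD1 v S); apply: leq_trans.
by rewrite -add1n leq_add2r leq_b1.
Qed.

End Colouring.

(** * The binomial random graph *)

Section RandomGraph.
Context {R : realType} {n : nat} (p : R).
Hypothesis p01 : 0 <= p <= 1.
Implicit Types (E : {set {set 'I_n}}) (A Q : pred {set {set 'I_n}}) (U : {set 'I_n}).

(** Giving probability 0 to sets that are not pairs makes the random graph a product measure over
    all sets of vertices. *)
Definition edge_prob (e : {set 'I_n}) : R := if e \in pairs n then p else 0.

Lemma edge_prob01 e : 0 <= edge_prob e <= 1.
Proof. by rewrite /edge_prob; case: ifP => // _; rewrite lexx ler01. Qed.

Lemma gnp_probE A : gnp_prob p A = pr edge_prob A.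
Proof.
rewrite /gnp_prob /pr /esp big_mkcond; apply: eq_bigr => E _.
transitivity (gnp_weight p E * (A E)%:R); first by case: (A E); rewrite ?mulr1 ?mulr0.
congr (_ * _); rewrite /weight (bigID (mem (pairs n))) /= /gnp_weight.
rewrite [X in _ = X * _](eq_bigr (fun e => if e \in E then p else 1 - p)); last first.
  by move=> e eP; rewrite /edge_prob eP.
case: ifPn => [EP|/subsetPn[e eE eP]].
  rewrite [X in _ = _ * X]big1 ?mulr1// => e eP; rewrite /edge_prob (negPf eP) subr0.
  by case: ifP => // eE; rewrite (fintype.subsetP EP) in eP.
by rewrite [X in _ = _ * X](bigD1 e)//= eE /edge_prob (negPf eP) mul0r mulr0.
Qed.

(** Sparseness concerns the complement graph on [U]: each vertex has less than a sixteenth of about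
    the expected number of non-neighbours. *)
Definition sparse_at E U :=
  [forall v in U, #|nonnbrs E U v|%:R < (1 - p) / 16 * #|U|%:R].

Definition inner_pairs U := [set e : {set 'I_n} | e \subset U & #|e| == 2%N]%SET.

Lemma card_missing_pairs E U :
  (#|inner_pairs U :\: E| <= \sum_(v in U) #|nonnbrs E U v|)%N.
Proof.
apply: (@leq_trans #|(\bigcup_(v in U) [set [set v; w] | w in nonnbrs E U v])%SET|).
  apply/subset_leq_card/fintype.subsetP => e.
  rewrite finset.in_setD finset.inE => /and3P[eE eU /cards2P[v [w [vw evw]]]].
  have vU : v \in U by rewrite (fintype.subsetP eU)// evw finset.in_set2 eqxx.
  have wU : w \in U by rewrite (fintype.subsetP eU)// evw finset.in_set2 eqxx orbT.
  apply/finset.bigcupP; exists v => //; rewrite evw; apply/imsetP; exists w => //.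
  by rewrite finset.inE wU eq_sym vw -evw.
elim/big_ind2: _ => [|A1 m1 A2 m2 h1 h2|v _]; first by rewrite finset.cards0.
  by apply: leq_trans (leq_add h1 h2); rewrite leq_card_setU.
exact: leq_imset_card.
Qed.

(** Let [X] be the number of missing pairs inside [U]. Sparseness forces [X <= c], so the
    probability is at most [expR c] times the expectation of [expR (- X)]. Each pair contributes a
    factor at most [expR (- ((1 - p) / 2))], and the product is at most [expR (- (2 * c))]. *)
Lemma pr_sparse_at U : (2 <= #|U|)%N ->
  pr edge_prob (fun E => sparse_at E U) <= expR (- ((1 - p) / 16 * #|U|%:R ^+ 2)).
Proof.
move=> U2; have /andP[p0 p1] := p01.
pose h e : R := if e \in inner_pairs U then expR (-1) else 1.
have hE E : \prod_e (if e \in E then 1 else h e) = expR (- #|inner_pairs U :\: E|%:R).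
  rewrite -mulN1r expRM_natr.
  rewrite -[expR _ ^+ _]prodr_const [RHS]big_mkcond; apply: eq_bigr => e _ /=.
  by rewrite finset.in_setD /h; case: (e \in E).
set c := (1 - p) / 16 * #|U|%:R ^+ 2.
apply: (@le_trans _ _ (expR c * esp edge_prob (fun E => \prod_e (if e \in E then 1 else h e)))).
  rewrite -espZ; apply: le_esp => [e|E]; first exact: edge_prob01.
  rewrite hE -expRD; case: (boolP (sparse_at E U)) => [sp|_]; last exact: expR_ge0.
  rewrite -[leLHS]expR0 ler_expR subr_ge0.
  have := card_missing_pairs E U; rewrite -(ler_nat R) => /le_trans; apply.
  rewrite natr_sum; apply: (@le_trans _ _ (\sum_(v in U) (1 - p) / 16 * #|U|%:R)).
    by apply: ler_sum => v vU; rewrite ltW//; move/forall_inP: sp; apply.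
  by rewrite sumr_const -[_ *+ _]mulr_natr -mulrA -expr2.
rewrite esp_prod.
have e2 : expR (-1) <= 1 / 2 :> R.
  rewrite expRN div1r lef_pV2 ?posrE ?expR_gt0 ?ltr0n//.
  by apply: le_trans (expR_ge1Dx 1); lra.
have facE e : edge_prob e * 1 + (1 - edge_prob e) * h e <=
    (if e \in inner_pairs U then expR (- ((1 - p) / 2)) else 1).
  rewrite /h; case: ifPn => [|_]; last by lra.
  rewrite finset.inE => /andP[_ e2']; rewrite /edge_prob finset.inE e2'.
  by apply: le_trans (expR_ge1Dx _); nra.
have -> : - c = c + - (2 * c) by ring.
rewrite [leRHS]expRD ler_wpM2l ?expR_ge0//.
apply: (@le_trans _ _ (\prod_e (if e \in inner_pairs U then expR (- ((1 - p) / 2)) else 1))).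
  apply: ler_prod => e _; rewrite facE andbT /h; have /andP[f0 f1] := edge_prob01 e.
  apply: addr_ge0; apply: mulr_ge0; rewrite ?subr_ge0 ?ler01//.
  by case: ifP; rewrite ?expR_ge0 ?ler01.
rewrite -big_mkcond /= prodr_const -expRM_natr ler_expR cards_draws.
(* For [u >= 2] one has [u ^ 2 <= 2 * u * (u - 1)]. *)
have : #|U|%:R ^+ 2 <= 4 * 'C(#|U|, 2)%:R :> R.
  rewrite -natrX -natrM ler_nat.
  have := bin_ffact #|U| 2; rewrite !ffactnS ffactn0 muln1 (_ : 2`! = 2)%N//.
  by move: #|U| U2 => u; move: 'C(u, 2) => b; nia.
rewrite /c; nra.
Qed.

Lemma sum_expr_card (x : R) : \sum_(U : {set 'I_n}) x ^+ #|U| = (x + 1) ^+ n.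
Proof.
have := @bigA_distr R 0 1 *%R +%R 'I_n (fun=> x) (fun=> 1).
rewrite big_const_ord iter_mulr_1 => ->; apply: eq_bigr => U _.
by rewrite -big_mkcond prodr_const.
Qed.

(** Union bound. As [m <= #|U|], one of the two factors [#|U|] in the exponent is replaced by [m],
    giving the bound [x ^+ #|U|]. The sum over nonempty sets is [(x + 1) ^+ n - 1]; the empty set is
    excluded because [m > 0]. *)
Lemma pr_exists_sparse (m : R) : 2 <= m ->
  pr edge_prob (fun E => [exists U : {set 'I_n}, (m <= #|U|%:R) && sparse_at E U])
    <= expR (n%:R * expR (- ((1 - p) / 16 * m))) - 1.
Proof.
move=> m2; have /andP[p0 p1] := p01; set x := expR (- _).
have x0 : 0 <= x by exact: expR_ge0.
apply: (@le_trans _ _ (\sum_(U : {set 'I_n} | m <= #|U|%:R) x ^+ #|U|)).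
  apply: (@le_trans _ _ (esp edge_prob (fun E =>
      \sum_(U : {set 'I_n} | m <= #|U|%:R) (sparse_at E U)%:R))).
    apply: le_esp => [e|E]; first exact: edge_prob01.
    case: existsP => [[U /andP[mU sU]]|_]; last by apply: sumr_ge0.
    by rewrite (bigD1 U)//= sU lerDl sumr_ge0.
  rewrite esp_sum; apply: ler_sum => U mU.
  have U2 : (2 <= #|U|)%N by rewrite -(ler_nat R); lra.
  apply: le_trans (pr_sparse_at _ U2) _.
  have : 0 <= (1 - p) / 16 * #|U|%:R * (#|U|%:R - m).
    by rewrite !mulr_ge0 ?subr_ge0 ?invr_ge0.
  by rewrite -expRM_natr ler_expR; lra.
have := sum_expr_card x; rewrite (bigD1 finset.set0)//= finset.cards0 expr0 => sx.
apply: (@le_trans _ _ ((x + 1) ^+ n - 1)).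
  rewrite -sx [1 + _]addrC addrK [leLHS]big_mkcond [leRHS]big_mkcond /=.
  apply: ler_sum => U _; case: eqVneq => [->|_] /=.
    by rewrite finset.cards0; case: ifP => // m0; exfalso; move: m0; lra.
  by case: ifP => _; rewrite // exprn_ge0.
by rewrite lerD2r mulrC expRM_natr lerXn2r ?nnegrE ?expR_ge0 ?addr_ge0// addrC expR_ge1Dx.
Qed.

Lemma pr_chi_threshold (eps : R) : 0 < eps <= 1 ->
  exists k, eps <= pr edge_prob (fun E => (chi E <= k)%N) /\
            pr edge_prob (fun E => (chi E < k)%N) <= eps.
Proof.
move=> /andP[eps0 eps1].
have ex : exists k, eps <= pr edge_prob (fun E => (chi E <= k)%N).
  exists n; rewrite /pr (eq_esp _ _ (fun=> 1)) ?esp_cst// => E.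
  rewrite (_ : (chi E <= n)%N) //.
  by apply/chi_leP/colorable_onT/colorable_n.
exists (ex_minn ex); case: ex_minnP => k hk min; split=> //.
(* For [k = 0] the event [chi E < k] is empty; otherwise minimality is applied to the
   predecessor. *)
case: k hk min => [_ _|k hk min].
  by rewrite /pr (eq_esp _ _ (fun=> 0)) ?esp_cst ?ltW.
rewrite leNgt; apply/negP => /ltW h; suff : (k.+1 <= k)%N by rewrite ltnn.
exact: min.
Qed.

(** The [n] stars serve as blocks in the tail bound, and the number of deleted vertices vanishes
    exactly when [chi E <= k]. *)
Lemma pr_max_colorable (r : R) k : 0 < r -> (0 < n)%N ->
    4 * n%:R / r ^+ 2 <= pr edge_prob (fun E => (chi E <= k)%N) ->
  pr edge_prob (fun E => r < (n - max_colorable k E)%:R) <= 4 * n%:R / r ^+ 2.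
Proof.
move=> r0 n0 h.
pose ss := [seq star v | v <- enum 'I_n].
have sz : size ss = n by rewrite size_map size_enum_ord.
have := @pr_gt_of_pr_eq0 R _ edge_prob edge_prob01 ss
  (fun E => (n - max_colorable k E)%:R) r.
rewrite sz; apply => //.
- move=> s /mapP[v _ ->] E E' EE'; rewrite natr1 ler_nat.
  have E'E : agree_off (star v) E' E by move=> e es; rewrite EE'.
  have := max_colorable_star k v E' E E'E.
  by have := max_colorable_le k E'; lia.
- move=> e; have [e2|e2] := boolP (#|e| == 2%N).
    have /card_gt0P[v ve] : (0 < #|e|)%N by rewrite (eqP e2).
    exists (star v); first by apply: map_f; rewrite mem_enum.
    by rewrite mem_filter ve mem_enum.
  exists (star (Ordinal n0)); first by apply: map_f; rewrite mem_enum.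
  by rewrite mem_filter e2 orbT mem_enum.
- apply: le_trans h _; apply: pr_le => [|E]; first exact: edge_prob01.
  by rewrite -max_colorable_eq => /eqP ->; rewrite subnn.
Qed.

(** Three bad events are discarded: [chi E < k], more than [r] deleted vertices, and failure of [Q].
    Otherwise a largest [k]-colourable set is coloured with [k] colours and its complement with [l]
    new ones. *)
Lemma chi_interval (w : R) (l : nat) Q : 2 <= w -> (0 < n)%N ->
    (forall E, Q E -> forall U, #|U|%:R <= w * Num.sqrt n%:R -> colorable_on E U l) ->
  exists k, 1 - 8 / w ^+ 2 - pr edge_prob (fun E => ~~ Q E) <=
    pr edge_prob (fun E => (k <= chi E <= k + l)%N).
Proof.
move=> w2 n0 HQ; have w0 : 0 < w by lra.
have w20 : 0 < w ^+ 2 by rewrite exprn_gt0.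
have n0R : 0 < n%:R :> R by rewrite ltr0n.
pose r := w * Num.sqrt n%:R.
have r0 : 0 < r by rewrite mulr_gt0 ?sqrtr_gt0.
have rE : 4 * n%:R / r ^+ 2 = 4 / w ^+ 2.
  by rewrite /r exprMn sqr_sqrtr ?ltW//; field; rewrite !gt_eqF.
(* The threshold must be at most 1, which is where [2 <= w] enters. *)
have [|k [hk1 hk2]] := pr_chi_threshold (4 / w ^+ 2).
  by rewrite divr_gt0//= ler_pdivrMr// mul1r; nra.
exists k; have := pr_max_colorable r k r0 n0; rewrite rE => /(_ hk1) hr.
set G := (fun E => (k <= chi E <= k + l)%N).
have := prC edge_prob G.
have : pr edge_prob (fun E => ~~ G E) <= pr edge_prob (fun E => (chi E < k)%N) +
   (pr edge_prob (fun E => r < (n - max_colorable k E)%:R) +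
    pr edge_prob (fun E => ~~ Q E)).
  apply: (@le_trans _ _ (pr edge_prob (fun E => (chi E < k)%N) +
      pr edge_prob (fun E => (r < (n - max_colorable k E)%:R) || ~~ Q E))); last first.
    by rewrite lerD2l; apply: pr_union => //; exact: edge_prob01.
  apply: pr_union; first exact: edge_prob01.
  move=> E; rewrite /G negb_and -ltnNge => /orP[->//|]; rewrite -ltnNge => lk.
  case: (boolP (Q E)) => [QE|]; rewrite ?orbT// orbF; apply/orP; right.
  rewrite ltNge; apply: contraTN lk => hr'; rewrite -leqNgt; apply/chi_leP.
  have [S SE cS] := max_colorableP k E.
  rewrite -(finset.setUCr S); apply: colorable_onU => //; apply: HQ => //.
  by rewrite finset.cardsCs finset.setCK card_ord cS.
have -> : 8 / w ^+ 2 = 4 / w ^+ 2 + 4 / w ^+ 2 by rewrite -mulrDl; congr (_ / _); ring.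
lra.
Qed.

End RandomGraph.

(** * Asymptotic estimates *)

Lemma expR_subr1_le (R : realType) (h : R) : 0 <= h <= 1 / 2 -> expR h - 1 <= 2 * h.
Proof.
move=> /andP[h0 h2]; have := expR_ge1Dx (- h); rewrite expRN => hV.
have e0 := expR_gt0 h.
have : (1 - h) * expR h <= 1 by rewrite -ler_pdivlMr // div1r.
by nra.
Qed.

Lemma natr_divn_le (R : realFieldType) (a t : nat) :
  (0 < t)%N -> (a %/ t)%:R <= a%:R / t%:R :> R.
Proof. by move=> t0; rewrite ler_pdivlMr ?ltr0n// -natrM ler_nat leq_divM. Qed.

Section Asymptotics.
Context {R : realType}.

(** With [n = y ^+ 8], the exponent 9 leaves a spare factor [y], so that
    [n * expR (- (y / 16)) <= K / y] tends to 0. The constant comes from the ninth Taylor term. *)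
Lemma expr9_le_expR :
  exists2 K : R, 0 < K & forall y, 0 <= y -> y ^+ 9 <= K * expR (y / 16).
Proof.
have f0 : 0 < 9`!%:R :> R by rewrite ltr0n fact_gt0.
exists (9`!%:R * 16 ^+ 9); first by rewrite mulr_gt0 ?exprn_gt0.
move=> y y0; have y16 : 0 <= y / 16 by lra.
have := @expR_ge1Dxn R (y / 16) 8 y16; move: (9`!%:R) f0 => f f0 h.
have {}h : (y / 16) ^+ 9 / f <= expR (y / 16) by lra.
move: h; rewrite ler_pdivrMr // expr_div_n ler_pdivrMr ?exprn_gt0//.
by rewrite -mulrA mulrC.
Qed.

(* [n = expR (8 t)], so that [expR t] is the eighth root of [n]. *)
Lemma pr_exists_sparse_le (n : nat) (p t K : R) :
    0 < K -> (forall y, 0 <= y -> y ^+ 9 <= K * expR (y / 16)) ->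
    0 <= p <= 1 -> n%:R = expR t ^+ 8 -> expR (- t) <= 1 - p ->
    2 <= t -> 2 * K <= t ->
  pr (edge_prob p) (fun E => [exists U : {set 'I_n},
      (expR t ^+ 2 <= #|U|%:R) && sparse_at p E U]) <= 2 * K / t.
Proof.
move=> K0 HK p01 nE qt t2 Kt; set y := expR t in nE *.
have yt : t <= y by apply: le_trans (expR_ge1Dx t); lra.
have y0 : 0 < y by exact: expR_gt0.
have t0 : 0 < t by lra.
apply: le_trans (pr_exists_sparse _ p01 _ _) _; first by nra.
set x := expR (- _).
(* Since [1 - p] is at least [1 / y], sets of size [y ^+ 2] still yield an exponent of at least
   [y / 16]. *)
have xy : x <= expR (- (y / 16)).
  rewrite ler_expR lerN2.
  have -> : y / 16 = expR (- t) * y ^+ 2 / 16 by rewrite expRN -/y; field; rewrite gt_eqF.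
  have : 0 <= y ^+ 2 by exact: sqr_ge0.
  by move=> /ler_wpM2r/(_ _ _ qt); lra.
have ny : n%:R * x <= K / y.
  rewrite nE; apply: (@le_trans _ _ (y ^+ 8 * expR (- (y / 16)))).
    by rewrite ler_wpM2l ?exprn_ge0 ?(ltW y0).
  rewrite expRN ler_pdivrMr ?expR_gt0// mulrAC ler_pdivlMr// -exprSr.
  exact: HK (ltW y0).
have Kyt : K / y <= K / t by rewrite ler_wpM2l ?lef_pV2 ?posrE// (ltW K0).
have Kt2 : K / t <= 1 / 2 by rewrite ler_pdivrMr//; lra.
have nx0 : 0 <= n%:R * x by rewrite mulr_ge0 ?expR_ge0.
apply: le_trans (expR_subr1_le _ _ _) _; first by rewrite nx0 /=; lra.
by rewrite -[2 * K / t]mulrA ler_wpM2l//; lra.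
Qed.

(** Starting from [expR t ^+ 3] vertices, [tau] passages to non-neighbourhoods lose a factor of at
    most [expR t] in total, so the size stays above the density threshold [expR t ^+ 2]. *)
Lemma colorable_on_dense (n : nat) (p t : R) (tau : nat) E (U : {set 'I_n}) :
    0 < 1 - p <= 1 -> (16 / (1 - p)) ^+ tau <= expR t -> (0 < tau)%N ->
    ~~ [exists U : {set 'I_n}, (expR t ^+ 2 <= #|U|%:R) && sparse_at p E U] ->
  colorable_on E U (#|U| %/ tau + (Num.truncn (expR t ^+ 3)).+1).
Proof.
move=> /andP[q0 q1] htau tau0 /existsPn Q; apply: colorable_on_greedy => // U' hU'.
apply: (@indep_greedy _ R E ((1 - p) / 16) (expR t ^+ 2)).
- by apply/andP; split; [rewrite divr_gt0|lra].
- move=> V mV; have := Q V; rewrite mV /= => /forall_inPn[v vV hv].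
  by exists v => //; rewrite leNgt.
- have yU : expR t ^+ 3 <= #|U'|%:R.
    by apply/ltW/(lt_le_trans (truncnS_gt _)); rewrite ler_nat.
  apply: le_trans yU; by rewrite invf_div [expR t ^+ 3]exprSr ler_wpM2l ?sqr_ge0.
Qed.

Lemma independent_share_le (t c M : R) (tau : nat) :
    0 < t -> 0 < c -> 0 <= M -> (0 < tau)%N -> t / c <= 2 * tau%:R ->
  M / tau%:R <= 16 * (M * c / (8 * t)).
Proof.
move=> t0 c0 M0 tau0 h; have tauR : 0 < tau%:R :> R by rewrite ltr0n.
have -> : 16 * (M * c / (8 * t)) = M * (2 * c / t) by field; rewrite gt_eqF.
rewrite ler_wpM2l // invf_ple ?posrE ?divr_gt0 ?mulr_gt0 // invf_div.
rewrite ler_pdivrMr ?mulr_gt0// mulrCA mulrA.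
by move: h; rewrite ler_pdivrMr.
Qed.

(** For [y = expR t], the one-colour-per-vertex remainder is of order [y ^+ 3], against a target of
    order [y ^+ 4 / t]. The quadratic bound [t ^+ 2 / 2 <= y] and [32 <= t * beta] give
    [16 * t <= beta * y], which suffices. *)
Lemma expR3_leftover_le (beta lb t w : R) :
    0 < beta -> beta <= lb -> 32 <= t * beta -> 2 <= t -> 1 <= w ->
  expR t ^+ 3 + 1 <= w * expR t ^+ 4 * lb / (8 * t).
Proof.
move=> beta0 blb tb t2 w1; have t0 : 0 < t by exact: lt_le_trans t2.
have t0' := ltW t0; set y := expR t.
have yt : t ^+ 2 / 2 <= y.
  have := @expR_ge1Dxn R t 1 t0'; rewrite (_ : 2`! = 2)%N// -/y => h.
  by apply: le_trans h; rewrite lerDr.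
have y1 : 1 <= y.
  by apply: le_trans (expR_ge1Dx t); rewrite lerDl.
have y31 : 1 <= y ^+ 3 by exact: exprn_ege1.
have y30 : 0 <= y ^+ 3 by exact: le_trans y31.
have y40 : 0 <= y ^+ 4 by rewrite exprn_ge0 // (le_trans ler01 y1).
have ty : 16 * t <= beta * y.
  apply: (@le_trans _ _ (beta * (t ^+ 2 / 2))).
    rewrite (_ : beta * (t ^+ 2 / 2) = t * beta / 2 * t); last by field.
    by rewrite ler_wpM2r // ler_pdivlMr // -natrM.
  by rewrite ler_wpM2l // ltW.
rewrite ler_pdivlMr ?mulr_gt0 //.
apply: (@le_trans _ _ (y ^+ 3 * (16 * t))).
  rewrite (_ : y ^+ 3 * (16 * t) = (y ^+ 3 + y ^+ 3) * (8 * t)); last by ring.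
  by rewrite ler_wpM2r ?mulr_ge0 // lerD2l.
apply: (@le_trans _ _ (y ^+ 3 * (beta * y))); first by rewrite ler_wpM2l.
rewrite (_ : y ^+ 3 * (beta * y) = beta * y ^+ 4); last by ring.
rewrite [leRHS]mulrC ler_pM ?(ltW beta0)//.
by rewrite ler_peMl.
Qed.

(** [D] is chosen so that [16 * expR lb <= expR (D * lb)] for every [lb >= beta]: the factor 16 is
    absorbed by [expR (16 * (lb / beta))]. *)
Lemma expr_inv_density_le (beta lb t : R) (D := 16 / beta + 1) (tau : nat) :
    0 < beta -> beta <= lb -> tau%:R <= t / (D * lb) ->
  (16 * expR lb) ^+ tau <= expR t.
Proof.
move=> beta0 blb h; have lb0 := lt_le_trans beta0 blb.
have D0 : 0 < D by rewrite addr_gt0 ?divr_gt0.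
apply: (@le_trans _ _ (expR (D * lb) ^+ tau)).
  rewrite lerXn2r ?nnegrE ?mulr_ge0 ?expR_ge0 //.
  have -> : D * lb = 16 * (lb / beta) + lb by rewrite /D; field; rewrite gt_eqF.
  rewrite expRD ler_wpM2r ?expR_ge0//.
  apply: le_trans (expR_ge1Dx _).
  have : 1 <= lb / beta by rewrite ler_pdivlMr// mul1r.
  by clear; lra.
by rewrite -expRM_natl ler_expR -ler_pdivlMr // mulr_gt0.
Qed.

Lemma few_colours (n : nat) (p w t K beta : R) (lb := ln (1 / (1 - p)))
    (D := 16 / beta + 1) :
    0 < beta -> beta <= lb -> 0 < p < 1 -> 2 <= w ->
    0 < K -> (forall y, 0 <= y -> y ^+ 9 <= K * expR (y / 16)) ->
    n%:R = expR t ^+ 8 -> 2 <= t -> 2 * K <= t -> 32 <= t * beta ->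
  exists (l : nat) (Q : pred {set {set 'I_n}}),
    [/\ forall E, Q E -> forall U : {set 'I_n}, #|U|%:R <= w * expR t ^+ 4 ->
          colorable_on E U l,
        pr (edge_prob p) (fun E => ~~ Q E) <= 2 * K / t &
        l%:R <= (16 * D + 1) * (w * expR t ^+ 4 * lb / (8 * t))].
Proof.
move=> beta0 blb /andP[p0 p1] w2 K0 HK nE t2 tK tb.
have t0 : 0 < t by exact: lt_le_trans t2.
have lb0 := lt_le_trans beta0 blb.
have D0 : 0 < D by rewrite addr_gt0 ?divr_gt0.
have D1 : 1 <= D by rewrite lerDr divr_ge0 ?(ltW beta0).
have q0 : 0 < 1 - p by rewrite subr_gt0.
have q1 : 0 < 1 - p <= 1 by rewrite q0 lerBlDr lerDl ltW.
have p01 : 0 <= p <= 1 by rewrite !ltW.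
have qE : 1 - p = expR (- lb) by rewrite /lb div1r lnV // opprK lnK.
have w0 : 0 < w by exact: lt_le_trans w2.
have w1 : 1 <= w by apply: le_trans w2; rewrite ler1n.
set M := w * expR t ^+ 4.
have M0 : 0 < M by rewrite mulr_gt0 ?exprn_gt0 ?expR_gt0.
have aM : (Num.truncn M)%:R <= M by rewrite truncn_le ltW.
have Dlb0 : 0 < D * lb by rewrite mulr_gt0.
(* The logarithm of [n] in base [1 / (1 - p)] is [8 * t / lb]. In the first case it is at most
   [8 * D], so a colour per leftover vertex is affordable and [Q] can be trivial. *)
have [tD|tD] := leP t (D * lb).
  exists (Num.truncn M), (fun=> true); split.
  - move=> E _ U hU; apply: colorable_on_le (colorable_on_card E U).
    by rewrite truncn_ge_nat// ltW.
  - by rewrite /pr (eq_esp _ _ (fun=> 0)) ?esp_cst// !mulr_ge0 ?invr_ge0 ?ltW.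
  - apply: (le_trans aM); rewrite mulrA ler_pdivlMr ?mulr_gt0//.
    rewrite (_ : _ * (M * lb) = M * (8 * (D * lb) + (8 * D + 1) * lb)); last by ring.
    rewrite ler_wpM2l ?(ltW M0)//; apply: (@le_trans _ _ (8 * (D * lb))).
      by rewrite ler_wpM2l.
    by rewrite lerDl mulr_ge0 ?(ltW lb0) // addr_ge0 // mulr_ge0 // ltW.
pose x := t / (D * lb).
have x1 : 1 <= x by rewrite ler_pdivlMr// mul1r ltW.
pose tau := Num.truncn x.
have tau0 : (0 < tau)%N by rewrite truncn_gt0.
have taux : tau%:R <= x by rewrite truncn_le (le_trans ler01 x1).
(* As [tau >= 1], rounding down costs at most a factor 2. *)
have xtau : x <= 2 * tau%:R.
  apply/ltW/(lt_le_trans (truncnS_gt x)).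
  by rewrite -natrM ler_nat mul2n -addnn -addn1 leq_add2l.
have htau : (16 / (1 - p)) ^+ tau <= expR t.
  by rewrite qE expRN invrK; apply: expr_inv_density_le beta0 blb taux.
exists (Num.truncn M %/ tau + (Num.truncn (expR t ^+ 3)).+1)%N,
  (fun E => ~~ [exists U : {set 'I_n}, (expR t ^+ 2 <= #|U|%:R) && sparse_at p E U]).
split.
- move=> E QE U hU.
  apply: colorable_on_le (colorable_on_dense n p t tau E U q1 htau tau0 QE).
  by rewrite leq_add2r leq_div2r// truncn_ge_nat// ltW.
(* The lower bound [expR (- t) <= 1 - p] holds in this case, as [lb <= D * lb < t]. *)
- apply: le_trans (pr_exists_sparse_le n p t K K0 HK p01 nE _ t2 tK); last first.
    rewrite qE ler_expR lerN2; apply: le_trans (ltW tD).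
    by rewrite ler_peMl ?(ltW lb0).
  by apply: pr_le => [e|E]; [exact: edge_prob01|rewrite negbK].
- rewrite natrD mulrDl mul1r; apply: lerD.
    apply: le_trans (natr_divn_le _ _ _ tau0) _.
    apply: (@le_trans _ _ (M / tau%:R)); first by rewrite ler_wpM2r.
    rewrite (_ : 16 * D * _ = 16 * (M * (D * lb) / (8 * t))); last by ring.
    exact: (independent_share_le _ _ _ _ t0 Dlb0 (ltW M0) tau0 xtau).
  apply: le_trans (expR3_leftover_le beta lb t w beta0 blb tb t2 w1).
  by rewrite -natr1 lerD2r truncn_le exprn_ge0 ?expR_ge0.
Qed.

(** Non-asymptotic form with constants depending on [gamma] alone: [beta] bounds [ln (1 / (1 - p))]
    from below uniformly in [p]. *)
Lemma chi_interval_logb (gamma : R) : 0 < gamma < 1 ->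
  exists C T K : R, [/\ 0 < C, 0 < K &
  forall (n : nat) (p w : R), gamma <= p < 1 -> 2 <= w -> (0 < n)%N ->
    T <= ln n%:R / 8 ->
    exists k : nat, 1 - 8 / w ^+ 2 - K / (ln n%:R / 8) <=
      gnp_prob p (fun E : {set {set 'I_n}} => (k%:R <= (chi E)%:R :> R) &&
        ((chi E)%:R <= (k%:R : R) + (Num.floor (C * w * Num.sqrt n%:R
                                 / logb (1 / (1 - p)) n%:R))%:~R))].
Proof.
move=> /andP[g0 g1].
pose beta : R := - ln (1 - gamma).
have beta0 : 0 < beta by rewrite oppr_gt0 ln_lt0// subr_gt0 g1 ltrBlDr ltrDl.
pose D : R := 16 / beta + 1.
have D0 : 0 < D by rewrite addr_gt0 ?divr_gt0.
have [K K0 HK] := expr9_le_expR.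
have b32 : 0 < 32 / beta by rewrite divr_gt0.
(* The second witness adds up the three lower bounds on [t] that [few_colours] asks for. *)
exists (16 * D + 1), (32 / beta + 2 * K + 2), (2 * K); split.
- by rewrite addr_gt0 ?mulr_gt0.
- by rewrite mulr_gt0.
move=> n p w /andP[gp p1] w2 n0; set t := ln n%:R / 8 => Tt.
have [t2 tK tb] : [/\ 2 <= t, 2 * K <= t & 32 / beta <= t].
  by move: b32 K0 Tt; clear; move: (32 / beta) t => u v ? ? ?; split; lra.
have t0 : 0 < t by exact: lt_le_trans t2.
have {}tb : 32 <= t * beta by rewrite -ler_pdivrMr.
have n0R : 0 < n%:R :> R by rewrite ltr0n.
have lnE : ln n%:R = 8 * t by rewrite /t; field.
have nE : n%:R = expR t ^+ 8 by rewrite -expRM_natl -lnE lnK.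
have sqE : Num.sqrt n%:R = expR t ^+ 4.
  by rewrite nE (exprM _ 4 2) sqrtr_sqr ger0_norm // exprn_ge0 ?expR_ge0.
have p0 : 0 < p by exact: lt_le_trans gp.
have p01 : 0 <= p <= 1 by rewrite !ltW.
have blb : beta <= ln (1 / (1 - p)).
  by rewrite div1r lnV ?posrE ?subr_gt0// lerN2 ler_ln ?posrE ?subr_gt0// lerB.
have p0p1 : 0 < p < 1 by rewrite p0.
have [l [Q [HQ prQ lC]]] :=
  few_colours n p w t K beta beta0 blb p0p1 w2 K0 HK nE t2 tK tb.
rewrite -sqE in HQ lC.
have [k hk] := chi_interval p p01 w l Q w2 n0 HQ.
exists k; rewrite gnp_probE.
apply: (@le_trans _ _ (pr (edge_prob p) (fun E => (k <= chi E <= k + l)%N))).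
  by apply: le_trans hk; rewrite lerD2l lerN2.
apply: pr_le => [e|E /andP[kE Ekl]]; first exact: edge_prob01.
rewrite ler_nat kE /=; apply: (@le_trans _ _ (k + l)%:R); first by rewrite ler_nat.
(* Since [l] is an integer, a real upper bound on it passes to the floor. *)
rewrite natrD lerD2l -[l%:R]/((l : int)%:~R) ler_int floor_ge_int.
by apply: (le_trans lC); rewrite /logb lnE invf_div -!mulrA lexx.
Qed.

End Asymptotics.

(** * Passage to the limit *)

Theorem theorem4 (R : realType) (gamma : R) (hgamma : 0 < gamma < 1) :
  exists C : R, 0 < C /\
  forall (omega p : nat -> R),
    omega n @[n --> \oo] --> +oo ->
    (forall n, gamma <= p n < 1) ->
    exists a : nat -> R,
      @gnp_prob R n (p n)
        (fun E => (a n <= (chi E)%:R) &&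
                  ((chi E)%:R <= a n +
                     (Num.floor (C * omega n * Num.sqrt n%:R
                                 / logb (1 / (1 - p n)) n%:R))%:~R))
        @[n --> \oo] --> (1 : R).
Proof.
have [C [T [K [C0 K0 H]]]] := chi_interval_logb gamma hgamma.
exists C; split=> // omega p omegaoo hp.
pose good n k := 1 - 8 / omega n ^+ 2 - K / (ln n%:R / 8) <=
  gnp_prob (p n) (fun E : {set {set 'I_n}} => (k%:R <= (chi E)%:R :> R) &&
        ((chi E)%:R <= (k%:R : R) + (Num.floor (C * omega n * Num.sqrt n%:R
                                 / logb (1 / (1 - p n)) n%:R))%:~R)).
(* Left endpoints are chosen for all [n] at once; the value 0 fills in the [n] to which the estimate
   does not apply. *)
have /choice[k hk] : forall n, exists k : nat,
    2 <= omega n -> (0 < n)%N -> T <= ln n%:R / 8 -> good n k.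
  move=> n; have [w2|w2] := leP 2 (omega n); last by exists 0%N.
  have [n0|n0] := posnP n; first by exists 0%N.
  have [Tn|Tn] := leP T (ln n%:R / 8); last by exists 0%N.
  by have [k hk] := H n (p n) (omega n) (hp n) w2 n0 Tn; exists k.
exists (fun n => (k n)%:R).
apply/cvgrPdist_le => eps eps0; near=> n.
have w2 : 2 <= omega n by near: n; move/cvgryPge: omegaoo; exact.
(* Together with [2 <= omega n] this makes [8 / omega n ^+ 2] at most [eps / 2]; the bound [teps]
   does the same for the other error term. *)
have weps : 16 / eps <= omega n by near: n; move/cvgryPge: omegaoo; exact.
have n0 : (0 < n)%N by near: n; exact: nbhs_infty_gt.
have n0R : 0 < n%:R :> R by rewrite ltr0n.
have lnn (A : R) : expR (8 * A) <= n%:R -> A <= ln n%:R / 8.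
  by rewrite -{1}(@lnK _ n%:R) // ler_expR; lra.
have tT : T <= ln n%:R / 8 by apply: lnn; near: n; exact: nbhs_infty_ger.
have teps : 2 * K / eps <= ln n%:R / 8 by apply: lnn; near: n; exact: nbhs_infty_ger.
have := hk n w2 n0 tT; rewrite /good.
have := hp n => /andP[gp p1].
have p01 : 0 <= p n <= 1 by apply/andP; split; move: hgamma => /andP[]; lra.
rewrite gnp_probE; set P := pr _ _ => hP.
have P1 : P <= 1.
  rewrite -[leRHS](esp_cst (@edge_prob R n (p n)) 1); apply: le_esp => [e|E].
    exact: edge_prob01.
  by rewrite lern1 leq_b1.
have h1 : 8 / omega n ^+ 2 <= eps / 2.
  rewrite ler_pdivrMr ?exprn_gt0//; last by lra.
  by move: weps; rewrite ler_pdivrMr// => ?; nra.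
have h2 : K / (ln n%:R / 8) <= eps / 2.
  have t0 : 0 < ln n%:R / 8 :> R.
    by apply: lt_le_trans teps; rewrite divr_gt0// mulr_gt0.
  rewrite ler_pdivrMr//; move: teps; rewrite ler_pdivrMr//; lra.
by rewrite ger0_norm ?subr_ge0//; lra.
Unshelve. all: by end_near.
Qed.
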